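(* Let $\mathcal{S}$ be a countable set and let $\pi_1, \pi_2, \dots$ be discrete probability distributions on $\mathcal{S}$ (i.e., each $\pi_i : \mathcal{S} \to [0,1]$ satisfies $\sum_{s \in \mathcal{S}} \pi_i(s) = 1$). Then there exists an infinite sequence $s_1, s_2, \dots$ of elements of $\mathcal{S}$ such that for all integers $k \geq 1$ and all $s \in \mathcal{S}$, $$\left| N_k(s) - P_k(s) \right| < 1,$$ where $N_k(s) := \#\{i : 1 \leq i \leq k \text{ and } s_i = s\}$ and $P_k(s) := \sum_{i=1}^k \pi_i(s)$. *)

(* Defs.v *)
From HB Require Import structures.
From mathcomp Require Import all_boot all_order all_algebra.
From mathcomp Require Import all_classical all_reals all_analysis.

Set Implicit Arguments.
Unset Strict Implicit.
Unset Printing Implicit Defensive.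

Import Order.TTheory GRing.Theory Num.Theory.

Local Open Scope classical_set_scope.
Local Open Scope ring_scope.

(* The sum over the whole (finite or countably infinite) type S is the
   unconditional sum of nonnegative terms, taken in the extended reals. *)
Definition discrete_distribution (R : realType) (S : countType)
    (p : S -> R) : Prop :=
  (forall s, 0 <= p s <= 1) /\ (\esum_(s in [set: S]) (p s)%:E = 1)%E.

Definition visit_count (S : countType) (u : nat -> S) (k : nat) (s : S) : nat :=
  count (fun i => u i == s) (index_iota 1 k.+1).

Definition prob_sum (R : realType) (S : countType) (p : nat -> S -> R)
    (k : nat) (s : S) : R :=
  \sum_(1 <= i < k.+1) p i s.

(* Main.v *)
Require Import Defs.
From HB Require Import structures.
From mathcomp Require Import all_boot all_order all_algebra.
From mathcomp Require Import all_classical all_reals all_analysis.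
From mathcomp Require Import lra.

(** View the [j]-th visit to [s] as a unit job, released at the first time [t]
    with [P_t(s) > j - 1] and due at the first time [t] with [P_t(s) >= j]; the
    bound [|N_k - P_k| < 1] holds as soon as all jobs are done in their windows.
    Schedule by earliest deadline first.  If a deadline [T] is missed, let [t0]
    be the last time up to [T] at which a job with deadline beyond [T] was run
    (or [0]).  Every job run in [(t0, T]], as well as the missed one, is released
    after [t0] and due by [T]; there are at most
    [\sum_s (P_T(s) - P_t0(s)) <= T - t0] such jobs, one too few. *)

Set Implicit Arguments.
Unset Strict Implicit.
Unset Printing Implicit Defensive.

Import Order.TTheory GRing.Theory Num.Theory.

Local Open Scope ring_scope.

Section DiscreteDistribution.
Variables (R : realType) (S : countType) (p : S -> R).
Hypothesis hp : discrete_distribution p.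

Lemma discrete_distribution_ge0 s : 0 <= p s.
Proof. by case: hp => /(_ s) /andP[]. Qed.

Lemma sum_discrete_distribution_le1 (F : seq S) :
  uniq F -> \sum_(s <- F) p s <= 1.
Proof.
move=> uF; case: hp => _ sum1; rewrite -lee_fin -sum1 -sumEFin.
apply: esum_ge; exists [set` F]%classic; last by rewrite fsbig_seq.
by split=> //; exact: finite_seq.
Qed.

Lemma sum_discrete_distribution_support (F : seq S) :
  uniq F -> (forall s, s \notin F -> p s = 0) -> \sum_(s <- F) p s = 1.
Proof.
move=> uF p0; case: hp => _ sum1; apply: EFin_inj.
rewrite -sum1 -sumEFin fsbig_seq// -esum_fset; last 2 first.
- exact: finite_seq.
- by move=> s _; rewrite lee_fin discrete_distribution_ge0.
rewrite esum_mkcond; apply: eq_esum => s _.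
by case: ifPn => //; rewrite mem_setE => /p0 ->.
Qed.

End DiscreteDistribution.

Section VisitCount.
Variables (S : countType) (u : nat -> S).

Lemma visit_count0 s : visit_count u 0 s = 0%N.
Proof. by []. Qed.

Lemma visit_countS k s :
  visit_count u k.+1 s = (visit_count u k s + (u k.+1 == s))%N.
Proof.
rewrite /visit_count.
have -> : index_iota 1 k.+2 = index_iota 1 k.+1 ++ [:: k.+1].
  by rewrite /index_iota !subSS !subn0 -[in LHS](addn1 k) iotaD.
by rewrite count_cat /= addn0.
Qed.

Lemma leq_visit_count s : {homo visit_count u ^~ s : k l / (k <= l)%N}.
Proof.
apply: homo_leq => [k|k l m|k]; [exact: leqnn | exact: leq_trans |].
by rewrite visit_countS leq_addr.
Qed.

Lemma sum_visit_count (F : seq S) k :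
  uniq F -> (forall i, (0 < i <= k)%N -> u i \in F) ->
  (\sum_(s <- F) visit_count u k s = k)%N.
Proof.
move=> uF; elim: k => [|k IH] uFk; first by rewrite big1.
under eq_bigr do rewrite visit_countS.
rewrite big_split /= IH; last first.
  by move=> i /andP[i0 ik]; rewrite uFk// i0 leqW.
rewrite (bigD1_seq (u k.+1)) ?uFk ?ltnSn//= eqxx big1 ?addn0 ?addn1// => s.
by rewrite eq_sym => /negPf ->.
Qed.

(** Serves to pass from a final count to the slot where it was reached, the only slot about which
    the scheduling rule says something. *)
Lemma last_visit s k l : (visit_count u k s < visit_count u l s)%N ->
  exists t, [/\ (k < t <= l)%N, u t = s & visit_count u t s = visit_count u l s].
Proof.
elim: l => [|l IH]; first by rewrite visit_count0.
have [kl|lk] := leqP k l; last by rewrite ltnNge leq_visit_count.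
case: (eqVneq (u l.+1) s) => [us _|us].
  by exists l.+1; rewrite ltnS kl leqnn.
rewrite visit_countS (negPf us) addn0 => /IH[t [/andP[kt tl] ut Nt]].
by exists t; rewrite kt leqW.
Qed.

End VisitCount.

Lemma prob_sum0 (R : realType) (S : countType) (p : nat -> S -> R) s :
  prob_sum p 0 s = 0.
Proof. by rewrite /prob_sum big_geq. Qed.

Lemma prob_sumS (R : realType) (S : countType) (p : nat -> S -> R) k s :
  prob_sum p k.+1 s = prob_sum p k s + p k.+1 s.
Proof. by rewrite /prob_sum big_nat_recr. Qed.

(* For [s] with [N s] completed jobs, [N s < P_{k+1}(s)] means that its next job
   is released at time [k+1], and [N s + 1 <= P_T(s)] that it is due by [T]. *)
Definition earliest_deadline (R : realType) (S : countType) (p : nat -> S -> R)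
    (k : nat) (N : S -> nat) (s : S) : Prop :=
  (N s)%:R < prob_sum p k.+1 s /\
  forall T s', (N s')%:R < prob_sum p k.+1 s' ->
    (N s').+1%:R <= prob_sum p T s' -> (N s).+1%:R <= prob_sum p T s.

Section EarliestDeadlineFirst.
Variables (R : realType) (S : countType) (p : nat -> S -> R).
Hypothesis hp : forall i : nat, (1 <= i)%N -> discrete_distribution (p i).

Lemma ler_prob_sum s : {homo prob_sum p ^~ s : k l / (k <= l)%N >-> k <= l}.
Proof.
apply: homo_leq => [x|x y z|k]; [exact: lexx | exact: le_trans |].
by rewrite prob_sumS lerDl (discrete_distribution_ge0 (hp _)).
Qed.

Lemma sum_prob_sum_diff (F : seq S) k l : uniq F -> (k <= l)%N ->
  \sum_(s <- F) (prob_sum p l s - prob_sum p k s) <= l%:R - k%:R.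
Proof.
move=> uF; elim: l => [|l IH].
  by rewrite leqn0 => /eqP ->; rewrite subrr big1// => s _; rewrite subrr.
rewrite leq_eqVlt => /orP[/eqP <-|]; rewrite ?ltnS.
  by rewrite subrr big1// => s _; rewrite subrr.
move=> /IH IHl.
under eq_bigr do rewrite prob_sumS addrAC.
have := sum_discrete_distribution_le1 (hp (ltn0Sn l)) uF.
rewrite big_split /= -natr1; lra.
Qed.

(** By nonnegativity every summand vanishes off [F] too, so [F] carries the full mass of each
    distribution. *)
Lemma sum_prob_sum_support (F : seq S) k : uniq F ->
  (forall s, s \notin F -> prob_sum p k s = 0) ->
  \sum_(s <- F) prob_sum p k s = k%:R.
Proof.
move=> uF; elim: k => [|k IH] P0.
  by rewrite big1// => s _; rewrite prob_sum0.
have PS0 s : s \notin F -> prob_sum p k s = 0 /\ p k.+1 s = 0.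
  move=> /P0; have := ler_prob_sum s (leq0n k).
  have := discrete_distribution_ge0 (hp (ltn0Sn k)) s.
  by rewrite prob_sum0 prob_sumS => *; split; lra.
under eq_bigr do rewrite prob_sumS.
rewrite big_split /= IH => [|s /PS0[]//].
by rewrite (sum_discrete_distribution_support (hp _)) ?natr1// => s /PS0[].
Qed.

(** Otherwise the cumulative probabilities at [k.+1] vanish off the finitely many points visited so
    far, and summing over these gives [k + 1 <= k]. *)
Lemma released_job_exists (u : nat -> S) k :
  exists s, (visit_count u k s)%:R < prob_sum p k.+1 s.
Proof.
apply: contrapT => /forallNP NP.
have {}NP s : prob_sum p k.+1 s <= (visit_count u k s)%:R.
  by rewrite leNgt; apply/negP/NP.
pose F := undup [seq u i | i <- iota 1 k].
have uF : uniq F := undup_uniq _.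
have uFk i : (0 < i <= k)%N -> u i \in F.
  by move=> ik; rewrite mem_undup map_f// mem_iota add1n ltnS.
have P0 s : s \notin F -> prob_sum p k.+1 s = 0.
  move=> sF; apply/eqP; rewrite eq_le.
  have := ler_prob_sum s (leq0n k.+1); rewrite prob_sum0 => ->; rewrite andbT.
  apply: le_trans (NP s) _; rewrite lern0 eqn0Ngt; apply/negP.
  rewrite -(visit_count0 u s) => /last_visit[t [tk ut _]].
  by move: sF; rewrite -ut uFk.
have : \sum_(s <- F) prob_sum p k.+1 s <= \sum_(s <- F) (visit_count u k s)%:R.
  by apply: ler_sum => s _; exact: NP.
by rewrite sum_prob_sum_support// -natr_sum sum_visit_count// ler_nat ltnn.
Qed.

Lemma earliest_deadline_exists k (N : S -> nat) :
  (exists s, (N s)%:R < prob_sum p k.+1 s) ->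
  exists s, earliest_deadline p k N s.
Proof.
move=> [s0 s0P].
pose due T := `[< exists2 s, (N s)%:R < prob_sum p k.+1 s
                           & (N s).+1%:R <= prob_sum p T s >].
(* Infinitely many jobs may be released, but deadlines are natural numbers, so a least one exists as
   soon as there is any. *)
have [exT|noT] := pselect (exists T, due T).
  case: (ex_minnP exT) => T /asboolP[s sP sT] minT.
  exists s; split=> // T' s' s'P s'T'.
  apply: le_trans sT (ler_prob_sum _ _); apply: minT.
  by apply/asboolP; exists s'.
(* No released job ever falls due, so any of them qualifies vacuously. *)
exists s0; split=> // T s' s'P s'T; exfalso; apply: noT.
by exists T; apply/asboolP; exists s'.
Qed.

Lemma earliest_deadline_schedule_exists :
  exists u : nat -> S,
    forall k, earliest_deadline p k (visit_count u k) (u k.+1).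
Proof.
have [s0 _] : exists s0 : S, true.
  apply: contrapT => noS.
  have := @sum_discrete_distribution_support _ _ _ (hp (ltn0Sn 0)) [::] isT.
  rewrite big_nil => /(_ (fun s => False_ind _ (noS (ex_intro _ s isT)))).
  by move/eqP; rewrite eq_sym oner_eq0.
(* The implication lets [next] be defined on all states, with [s0] as default where no job is
   released. *)
have /choice[next nextP] (x : nat * (S -> nat)) : exists s,
    (exists s', (x.2 s')%:R < prob_sum p x.1.+1 s') ->
    earliest_deadline p x.1 x.2 s.
  case: x => k N /=.
  have [/earliest_deadline_exists[s sP]|noC] :=
    pselect (exists s, (N s)%:R < prob_sum p k.+1 s); first by exists s.
  by exists s0.
(* The recursion carries only the counts; the value of [u] at [0] is never counted. *)
pose N := fix N k := if k is k'.+1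
  then fun s => (N k' s + (next (k', N k') == s))%N else fun=> 0%N.
pose u k := next (k.-1, N k.-1).
have Nu k : N k = visit_count u k.
  elim: k => [|k IH]; apply/funext => s; first by [].
  by rewrite visit_countS -IH.
exists u => k; rewrite /u /= Nu.
by apply: (nextP (k, _)); exact: released_job_exists.
Qed.

Variable u : nat -> S.
Hypothesis uP : forall k, earliest_deadline p k (visit_count u k) (u k.+1).

(** No job is run before its release, and cumulative probabilities never decrease. *)
Lemma visit_count_ltD1 k s : (visit_count u k s)%:R < prob_sum p k s + 1.
Proof.
elim: k => [|k IH]; first by rewrite prob_sum0 add0r ltr01.
rewrite visit_countS; case: eqVneq => [<-|_].
  by rewrite addn1 -natr1 ltrD2r; case: (uP k).
by rewrite addn0 (lt_le_trans IH)// lerD2r ler_prob_sum.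
Qed.

(** A released job due by [T] would have been preferred to the late one run at [t0]; hence a next
    job due by [T] is still unreleased at [t0]. *)
Lemma last_late_slot T : exists t0, [/\ (t0 <= T)%N,
    forall t, (t0 < t <= T)%N ->
      (visit_count u t (u t))%:R <= prob_sum p T (u t) &
    forall s, (visit_count u t0 s).+1%:R <= prob_sum p T s ->
      prob_sum p t0 s <= (visit_count u t0 s)%:R].
Proof.
(* Slot [0], where nothing is run, counts as late so that a last late slot exists. *)
pose late t := (t <= T)%N &&
  ((t == 0%N) || (prob_sum p T (u t) < (visit_count u t (u t))%:R)).
have ex_late : exists t, late t by exists 0%N; rewrite /late eqxx leq0n.
have late_le t : late t -> (t <= T)%N by case/andP.
case: (ex_maxnP ex_late late_le) => t0 /andP[t0T late_t0] maxt0.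
exists t0; split=> // [t /andP[t0t tT]|s].
  rewrite leNgt; apply: contraL t0t => lt; rewrite -leqNgt maxt0//.
  by rewrite /late tT lt orbT.
case: t0 {t0T maxt0} late_t0 => [|t0] /=; first by rewrite prob_sum0 ler0n.
rewrite visit_countS eqxx addn1 => late_t0 due_s.
have [_ /(_ T s) min_u] := uP t0.
have le_N := leq_visit_count u s (leqnSn t0).
(* The choice at slot [t0.+1] was made from the counts at [t0]. *)
apply: le_trans (_ : (visit_count u t0 s)%:R <= _); last by rewrite ler_nat.
rewrite leNgt; apply/negP => released_s.
have /(min_u released_s) : (visit_count u t0 s).+1%:R <= prob_sum p T s.
  by apply: le_trans due_s; rewrite ler_nat ltnS.
by rewrite leNgt late_t0.
Qed.

Lemma visit_count_gtB1 T s : prob_sum p T s - 1 < (visit_count u T s)%:R.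
Proof.
rewrite ltNge; apply/negP => missed.
have {}missed : (visit_count u T s).+1%:R <= prob_sum p T s.
  by rewrite -natr1; lra.
have [t0 [t0T early released]] := last_late_slot T.
(* All points visited up to [T] lie in [F], so the counts sum exactly to the elapsed time. *)
pose F := undup (s :: [seq u i | i <- iota 1 T]).
have uF : uniq F := undup_uniq _.
have sF : s \in F by rewrite mem_undup mem_head.
have uFT i : (0 < i <= T)%N -> u i \in F.
  move=> iT; rewrite mem_undup in_cons; apply/orP; right.
  by rewrite map_f// mem_iota add1n ltnS.
have sumN k : (k <= T)%N -> \sum_(r <- F) (visit_count u k r)%:R = k%:R :> R.
  move=> kT; rewrite -natr_sum sum_visit_count// => i /andP[i0 ik].
  by rewrite uFT// i0 (leq_trans ik).
(* The term [(r == s)%:R] stands for the missed job and raises the left total to [T - t0 + 1]. *)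
have : \sum_(r <- F) ((visit_count u T r)%:R - (visit_count u t0 r)%:R
           + (r == s)%:R : R)
    <= \sum_(r <- F) (prob_sum p T r - prob_sum p t0 r).
  apply: ler_sum => r _; have leN := leq_visit_count u r t0T.
  case: (eqVneq r s) => [->|_].
    have due_s : (visit_count u t0 s).+1%:R <= prob_sum p T s.
      by apply: le_trans missed; rewrite ler_nat ltnS leq_visit_count.
    have := released s due_s; rewrite -[true%:R]/1.
    by move: missed; rewrite -[_.+1%:R]natr1; lra.
  rewrite addr0; move: leN; rewrite leq_eqVlt => /orP[/eqP ->|ltN].
    by rewrite subrr subr_ge0 ler_prob_sum.
  (* The last job of [r] run by [T] is due by [T], hence so is its first job after [t0]. *)
  have [t [t0tT ut Nt]] := last_visit ltN.
  have := early t t0tT; rewrite ut Nt => leP.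
  have due_r : (visit_count u t0 r).+1%:R <= prob_sum p T r.
    by apply: le_trans leP; rewrite ler_nat.
  have := released r due_r; lra.
apply/negP; rewrite -ltNge.
apply: le_lt_trans (sum_prob_sum_diff uF t0T) _.
rewrite big_split /= sumrB !sumN// (bigD1_seq s)//= eqxx big1 => [|r /negPf ->//].
by rewrite addr0 ltrDl ltr01.
Qed.

End EarliestDeadlineFirst.

Theorem theorem2 (R : realType) (S : countType) (p : nat -> S -> R)
    (hp : forall i : nat, (1 <= i)%N -> discrete_distribution (p i)) :
  exists u : nat -> S, forall (k : nat) (s : S), (1 <= k)%N ->
    `|(visit_count u k s)%:R - prob_sum p k s| < 1.
Proof.
have [u uP] := earliest_deadline_schedule_exists hp.
exists u => k s _; have := visit_count_ltD1 hp uP k s.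
have := visit_count_gtB1 hp uP k s.
by rewrite ltr_norml => *; apply/andP; split; lra.
Qed.
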